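(* Let $n,m,l$ be positive integers with $m\leq\frac{n+1}{2}$, $l\geq n+1$, and $l$ an odd prime. If there exists a binary linear $[n,k,8m]$ code, then there exists a lattice of rank $n$ (in ${\bf R}^{n+1}$) with center density at least $\frac{2^{k-\frac{n}{2}}\cdot m^{n/2}}{l^{m-1}(n+1)^{1/2}}$.
   Context: A binary linear $[N,k,d]$ code is a $k$-dimensional subspace of ${\bf F}_2^N$ with minimum nonzero Hamming weight $d$. For a lattice ${\bf L}$ of rank $r$ with shortest nonzero vector length $\lambda$ and volume $\mathrm{Vol}({\bf L})$ (square root of the Gram determinant of a basis), the center density is $(\lambda/2)^r/\mathrm{Vol}({\bf L})$. *)

(* Defs.v *)
From HB Require Import structures.
From mathcomp Require Import all_boot all_order all_algebra.
From mathcomp Require Import boolp classical_sets reals exp.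
Set Implicit Arguments.
Unset Strict Implicit.
Unset Printing Implicit Defensive.
Import Order.TTheory GRing.Theory Num.Theory.
Local Open Scope classical_set_scope.
Local Open Scope ring_scope.

Definition hamming_weight (N : nat) (c : 'rV['F_2]_N) : nat :=
  #|[set i : 'I_N | c 0 i != 0]|.

(* The minimum weight is attained, so the zero code has no parameter d. *)
Definition is_binary_code (N k d : nat) (C : {vspace 'rV['F_2]_N}) : Prop :=
  [/\ \dim C = k,
      exists c, [/\ c \in C, c != 0 & hamming_weight c = d]
    & forall c, c \in C -> c != 0 -> (d <= hamming_weight c)%N].

(* MathComp-Analysis equips 'rV[R]_N with the sup norm, hence this one. *)
Definition euclidean_norm (R : realType) (N : nat) (v : 'rV[R]_N) : R :=
  Num.sqrt (\sum_(i < N) v 0 i ^+ 2).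

Definition zspan (R : realType) (r N : nat) (B : 'M[R]_(r, N)) : set 'rV[R]_N :=
  [set v | exists z : 'rV[int]_r, v = map_mx intr z *m B].

Definition is_lattice_basis (R : realType) (r N : nat)
    (L : set 'rV[R]_N) (B : 'M[R]_(r, N)) : Prop :=
  row_free B /\ L = zspan B.

Definition is_lattice (R : realType) (r N : nat) (L : set 'rV[R]_N) : Prop :=
  exists B : 'M[R]_(r, N), is_lattice_basis L B.

Definition is_shortest_length (R : realType) (N : nat)
    (L : set 'rV[R]_N) (lam : R) : Prop :=
  (exists v, [/\ L v, v != 0 & euclidean_norm v = lam]) /\
  (forall v, L v -> v != 0 -> lam <= euclidean_norm v).

Definition basis_volume (R : realType) (r N : nat) (B : 'M[R]_(r, N)) : R :=
  Num.sqrt (\det (B *m B^T)).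

(* The volume does not depend on the basis, so delta is determined by L. *)
Definition is_center_density (R : realType) (r N : nat)
    (L : set 'rV[R]_N) (delta : R) : Prop :=
  exists (B : 'M[R]_(r, N)) (lam : R),
    [/\ is_lattice_basis L B, is_shortest_length L lam
      & delta = (lam / 2) ^+ r / basis_volume B].

(* Main.v *)
(** Let [A_n] be the root lattice of integer vectors of length [n + 1] with zero
    sum, parametrized by the first [n] coordinates [z].  The lattice is the set
    of [z] whose reduction modulo 2 lies in the code and which satisfy
    [\sum_i z_i (i + 1)^j = 0] modulo [l] for [0 < j < m].  These are [n - k]
    congruences modulo 2 and [m - 1] modulo [l], so the index in [A_n] is at most
    [2^(n-k) l^(m-1)], while [A_n] has volume [sqrt (n + 1)].

    A nonzero vector has squared length at least [8m].  If some [z_i] is odd, it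
    has at least [8m] odd coordinates.  Otherwise half of it satisfies the same
    congruences modulo [l], and those alone force squared length [2m]: if it were
    less, the positive and the negative parts of [z] would be disjoint multisets of
    at most [m - 1 < l] nonzero residues with the same first [m - 1] power sums,
    hence the same elementary symmetric functions, so both would be empty. *)

Require Import Defs.
From mathcomp Require Import all_boot all_order all_algebra.
From mathcomp Require Import boolp classical_sets reals exp.
From mathcomp Require Import zify ring.
Set Implicit Arguments.
Unset Strict Implicit.
Unset Printing Implicit Defensive.
Import Order.TTheory GRing.Theory Num.Theory.
Local Open Scope ring_scope.

(** * Sublattices of [Z^n] cut out by congruences *)

Lemma det_1D_col_row (K : comNzRingType) (n : nat) (c : 'cV[K]_n) (r : 'rV[K]_n) :
  \det (1%:M + c *m r) = 1 + (r *m c) 0 0.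
Proof.
(* [P *m Q] and [Q *m P] are both block upper triangular, and their equal determinants are the two
   sides. *)
pose P := block_mx 1%:M (- c) r (1%:M : 'M_1).
pose Q := block_mx 1%:M 0 (- r) (1%:M : 'M_1).
have detQ : \det Q = 1 by rewrite det_lblock !det1 mulr1.
have detPQ : \det (P *m Q) = \det (1%:M + c *m r).
  rewrite mulmx_block !mulmx1 !mul1mx !mulmx0 !add0r mulNmx mulmxN opprK.
  by rewrite subrr det_ublock det1 mulr1.
have detQP : \det (Q *m P) = 1 + (r *m c) 0 0.
  rewrite mulmx_block !mulmx1 !mul1mx !mul0mx !addr0 mulNmx mulmxN opprK.
  rewrite addNr det_ublock det1 mul1r det_mx11.
  by rewrite !mxE eqxx addrC.
by rewrite -detPQ -detQP !det_mulmx mulrC.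
Qed.

Lemma congruence_kernel_basis (n p : nat) (c : 'cV[int]_n) : prime p ->
  exists U : 'M[int]_n, [/\ 0 < \det U, \det U <= p%:Z
    & forall z : 'rV_n, (exists w, z = w *m U) <-> (p %| ((z *m c) 0 0)%R)%Z].
Proof.
move=> p_pr; have p_gt0 := prime_gt0 p_pr.
(* If [p] divides all of [c], the congruence is vacuous and the index is 1 instead of [p]. *)
case: (boolP [forall i, (p %| (c i 0)%R)%Z]) => [/forallP pc|].
  exists 1%:M; rewrite det1; split=> // z; split=> [_|_].
    by rewrite mxE rpred_sum// => i _; rewrite dvdz_mull.
  by exists z; rewrite mulmx1.
rewrite negb_forall => /existsP[i pNci].
have /coprimezP[[a b] /= ab1] : coprimez p (c i 0).
  by rewrite coprimezE /= prime_coprime.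
pose e : 'rV[int]_n := delta_mx 0 i.
pose u := ((1 - a) * p) *: e^T - b *: c.
have ec : e *m c = (c i 0)%:M.
  by rewrite -rowE; apply/matrixP=> j k; rewrite !ord1 !mxE eqxx.
have ze (z : 'rV_n) : z *m e^T = (z 0 i)%:M.
  by rewrite trmx_delta -colE; apply/matrixP=> j k; rewrite !ord1 !mxE eqxx.
have eu : e *m u = (p%:Z - 1)%:M.
  rewrite mulmxBr -!scalemxAr ze ec !scale_scalar_mx -raddfB mxE !eqxx /=.
  by congr _%:M; lia.
(* The rows of [U] generate the kernel of [c] modulo [p]: its row [i] is [p] times
   the unit vector [e], and a row [j] different from [i] is the unit vector of [j]
   minus [b * c j 0] times [e], where [b] inverts [c i 0] modulo [p]. *)
pose U := 1%:M + u *m e.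
have detU : \det U = p by rewrite det_1D_col_row eu mxE eqxx mulr1n; ring.
have Uc : U *m c = p%:Z *: (a *: c + (c i 0 * (1 - a)) *: e^T).
  rewrite mulmxDl mul1mx -mulmxA ec mul_mx_scalar.
  rewrite /u; apply/colP=> j; rewrite !mxE.
  (* A zero multiple of the Bezout identity, added so that [ring] can conclude. *)
  have cj0 : c j 0 * (a * p + b * c i 0 - 1) = 0 by rewrite ab1 subrr mulr0.
  by rewrite -[LHS]addr0 -cj0; ring.
exists U; rewrite detU ltz_nat p_gt0; split=> // z; split.
  by case=> w ->; rewrite -mulmxA Uc -scalemxAr mxE dvdz_mulr.
move=> pzc.
have /dvdzP[q zuq] : (p %| ((z *m u) 0 0)%R)%Z.
  rewrite mulmxBr -!scalemxAr ze; move: pzc; rewrite !mxE /= mulr1n => pzc.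
  by rewrite rpredB//; [apply/dvdz_mulr/dvdz_mull | apply: dvdz_mull].
(* As [e *m u] is [p - 1], the rational inverse of [U] is [1 - p^-1 u e]; here [q] is [z u / p]. *)
exists (z - q *: e); rewrite mulmxDr mulmx1 mulmxA mulmxBl -scalemxAl eu.
rewrite [z *m u]mx11_scalar zuq scale_scalar_mx -raddfB mul_scalar_mx.
by apply/rowP=> j; rewrite !mxE; ring.
Qed.

(** One congruence at a time: in coordinates on the lattice with basis [T], the form [c] becomes
    [T *m c], and determinants multiply. *)
Lemma congruence_lattice_basis (n : nat) (s : seq (nat * 'cV[int]_n)) :
    all (fun pc => prime pc.1) s ->
  exists T : 'M[int]_n, [/\ 0 < \det T, \det T <= (\prod_(pc <- s) pc.1)%N%:Z
    & forall z : 'rV_n, (exists w, z = w *m T) <->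
        all (fun pc : nat * 'cV_n => (pc.1 %| ((z *m pc.2) 0 0)%R)%Z) s].
Proof.
elim: s => [_|[p c] s IHs /= /andP[p_pr s_pr]].
  exists 1%:M; rewrite det1 big_nil; split=> // z; split=> // _.
  by exists z; rewrite mulmx1.
have [T [detT_gt0 detT_le zT]] := IHs s_pr.
have [U [detU_gt0 detU_le zU]] := congruence_kernel_basis (T *m c) p_pr.
exists (U *m T); rewrite det_mulmx big_cons /=; split.
- exact: mulr_gt0.
- by rewrite PoszM ler_pM// ltW.
move=> z; split.
  case=> w ->; apply/andP; split; last by apply/zT; exists (w *m U); rewrite mulmxA.
  by rewrite mulmxA -[_ *m T *m c]mulmxA; apply/zU; exists w.
case/andP=> pzc /zT[w zw]; move: pzc; rewrite zw -mulmxA => /zU[v ->].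
by exists v; rewrite mulmxA.
Qed.

(** * Power sums and logarithmic derivatives *)

(* [e ^`() / e = - p] modulo ['X^M] *)
Definition neg_log_deriv (F : comNzRingType) (M : nat) (e p : {poly F}) : Prop :=
  exists q, e^`() + e * p = q * 'X^M.

Lemma neg_log_deriv1 (F : comNzRingType) (M : nat) :
  neg_log_deriv M (1 : {poly F}) 0.
Proof. by exists 0; rewrite derivC mulr0 addr0 mul0r. Qed.

Lemma neg_log_derivM (F : comNzRingType) (M : nat) (e1 p1 e2 p2 : {poly F}) :
  neg_log_deriv M e1 p1 -> neg_log_deriv M e2 p2 ->
  neg_log_deriv M (e1 * e2) (p1 + p2).
Proof.
move=> [q1 e1q1] [q2 e2q2]; exists (q1 * e2 + e1 * q2).
have -> : (q1 * e2 + e1 * q2) * 'X^M = q1 * 'X^M * e2 + e1 * (q2 * 'X^M) by ring.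
by rewrite -e1q1 -e2q2 derivM; ring.
Qed.

(** Geometric series: [1 - aX] times the sum telescopes to [a - a^(M+1) X^M]. *)
Lemma neg_log_deriv_linear (F : comNzRingType) (M : nat) (a : F) :
  neg_log_deriv M (1 - a *: 'X) (\sum_(j < M) a ^+ j.+1 *: 'X^j).
Proof.
exists (- (a ^+ M.+1)%:P).
have -> : \sum_(j < M) a ^+ j.+1 *: 'X^j = a *: \sum_(j < M) (a *: 'X) ^+ j.
  by rewrite scaler_sumr; apply: eq_bigr => j _; rewrite exprZn scalerA exprS.
rewrite derivB derivC sub0r derivZ derivX -scalerAr.
rewrite -[1 - _]opprB mulNr -subrX1 opprB scalerBr exprZn scalerA -exprS.
by rewrite addKr mulNr mul_polyC.
Qed.

(** Newton's identities in generating function form. *)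
Lemma neg_log_deriv_prod (F : comNzRingType) (I : finType) (M : nat) (a : I -> F)
    (k : I -> nat) :
  neg_log_deriv M (\prod_i (1 - a i *: 'X) ^+ k i)
    (\sum_(j < M) (\sum_i a i ^+ j.+1 *+ k i) *: 'X^j).
Proof.
have -> : \sum_(j < M) (\sum_i a i ^+ j.+1 *+ k i) *: 'X^j =
    \sum_i (\sum_(j < M) a i ^+ j.+1 *: 'X^j) *+ k i.
  rewrite (eq_bigr (fun j : 'I_M => \sum_i (a i ^+ j.+1 *: 'X^j) *+ k i)).
    by rewrite exchange_big; apply: eq_bigr => i _; rewrite sumrMnl.
  by move=> j _; rewrite scaler_suml; apply: eq_bigr => i _; rewrite scalerMnl.
apply: (big_ind2 (neg_log_deriv M)) => [||i _].
- exact: neg_log_deriv1.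
- by move=> *; apply: neg_log_derivM.
elim: (k i) => [|m IHm]; first exact: neg_log_deriv1.
by rewrite exprS mulrS; apply: neg_log_derivM => //; apply: neg_log_deriv_linear.
Qed.

(** The difference [D] has zero constant term and satisfies [D' + D p = 0] modulo [X^M]. This
    expresses [(v + 1) D_(v+1)] through lower coefficients, and [v + 1] is invertible up to [M]. *)
Lemma neg_log_deriv_inj (F : fieldType) (M : nat) (e1 e2 p : {poly F}) :
    (forall v, (0 < v <= M)%N -> v%:R != 0 :> F) ->
    (size e1 <= M.+1)%N -> (size e2 <= M.+1)%N -> e1`_0 = e2`_0 ->
    neg_log_deriv M e1 p -> neg_log_deriv M e2 p ->
  e1 = e2.
Proof.
move=> natF_neq0 size1 size2 e12_0 [q1 e1q1] [q2 e2q2].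
apply/eqP; rewrite -subr_eq0; set D := e1 - e2.
have Dq : D^`() + D * p = (q1 - q2) * 'X^M.
  by rewrite derivB !mulrBl -e1q1 -e2q2; ring.
have sizeD : (size D <= M.+1)%N.
  by rewrite (leq_trans (size_polyD _ _))// size_polyN geq_max size1.
suff D0 v : (v <= M)%N -> D`_v = 0.
  apply/eqP/polyP=> v; rewrite coef0; case: (leqP v M) => [/D0//|ltMv].
  by rewrite nth_default// (leq_trans sizeD).
elim/ltn_ind: v => -[|v] IHv lev; first by rewrite coefB e12_0 subrr.
have := congr1 (fun g : {poly F} => g`_v) Dq.
rewrite coefD coef_deriv coefM coefMXn lev big1 => [|j _].
  rewrite addr0 -mulr_natr => /eqP.
  by rewrite mulf_eq0 (negPf (natF_neq0 _ _))// orbF => /eqP.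
by rewrite IHv ?mul0r//; have := ltn_ord j; lia.
Qed.

(** Equal power sums make the two products [e] equal. A root [(a i)^-1] of one is then a root of the
    other, against disjointness. *)
Lemma power_sum_disjoint (F : fieldType) (I : finType) (M : nat) (a : I -> F)
    (k1 k2 : I -> nat) :
    (forall v, (0 < v <= M)%N -> v%:R != 0 :> F) ->
    injective a -> (forall i, a i != 0) ->
    (\sum_i k1 i <= M)%N -> (\sum_i k2 i <= M)%N ->
    (forall j, (j < M)%N ->
      \sum_i a i ^+ j.+1 *+ k1 i = \sum_i a i ^+ j.+1 *+ k2 i) ->
    (forall i, (k1 i == 0) || (k2 i == 0))%N ->
  forall i, k1 i = 0%N.
Proof.
move=> natF_neq0 a_inj a_neq0 le1 le2 psum disj i.
pose e (k : I -> nat) := \prod_i (1 - a i *: 'X) ^+ k i.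
have size_e k : (\sum_i k i <= M)%N -> (size (e k) <= M.+1)%N.
  move=> leM; apply: (@leq_trans (\sum_i k i).+1) => //.
  rewrite /e; elim/big_ind2: _ => [|x p y q lep leq|t _]; first by rewrite size_poly1.
    by rewrite (leq_trans (size_polyMleq _ _))//; lia.
  rewrite (leq_trans (size_poly_exp_leq _ _))// ltnS -[leqRHS]mul1n leq_mul//.
  suff : (size (1 - a t *: 'X)%R <= 2)%N by lia.
  rewrite (leq_trans (size_polyD _ _))// size_polyN size_poly1 geq_max /=.
  by rewrite (leq_trans (size_scale_leq _ _))// size_polyX.
have e_coef0 k : (e k)`_0 = 1.
  rewrite -horner_coef0 horner_prod big1// => t _.
  by rewrite horner_exp !hornerE subr0 expr1n.
have e12 : e k1 = e k2.
  apply: (neg_log_deriv_inj (M := M) natF_neq0) => //; try exact: size_e.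
  - by rewrite !e_coef0.
  - exact: neg_log_deriv_prod.
  under eq_bigr do rewrite psum//.
  exact: neg_log_deriv_prod.
apply/eqP; have := disj i; case: eqP => //= /eqP k1i /eqP k2i.
have /eqP := congr1 (fun p => p.[(a i)^-1]) e12.
rewrite !horner_prod (bigD1 i)//= horner_exp !hornerE divff// subrr.
rewrite expr0n (negPf k1i) mul0r eq_sym => /prodf_eq0[t _].
rewrite horner_exp !hornerE expf_eq0 subr_eq0 => /andP[k2t /eqP].
move/(congr1 ( *%R^~ (a i))); rewrite mul1r mulfVK// => /a_inj eq_it.
by move: k2t; rewrite -eq_it k2i.
Qed.

(** * Squared length on [A_n] and the congruences modulo [l] *)

(* Squared Euclidean length of the vector of the root lattice [A_n] whose first
   [n] coordinates are [z]; the last one is [- \sum_i z 0 i]. *)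
Definition root_norm (n : nat) (z : 'rV[int]_n) : nat :=
  (\sum_i `|z 0%R i| ^ 2 + `|(\sum_i z 0 i)%R| ^ 2)%N.

Definition pospart (x : int) : nat := if 0 <= x then `|x|%N else 0%N.

Lemma pospartB (x : int) : x = (pospart x)%:Z - (pospart (- x))%:Z.
Proof. by rewrite /pospart; do 2!case: ifP; lia. Qed.

(** Squares dominate absolute values. If the positive and negative parts sum to [P] and [N], the
    absolute values, last coordinate included, sum to [P + N + |P - N|], at least [2P]. *)
Lemma root_norm_ge (n : nat) (z : 'rV[int]_n) :
  ((\sum_i pospart (z 0 i)%R).*2 <= root_norm z)%N.
Proof.
have leX (a : nat) : (a <= a ^ 2)%N by case: a => // a; rewrite -mulnn leq_pmulr.
apply: (@leq_trans (\sum_i `|z 0%R i| + `|(\sum_i z 0 i)%R|)); last first.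
  by rewrite leq_add// leq_sum.
have -> : \sum_i z 0 i =
    (\sum_i pospart (z 0 i)%R)%N%:Z - (\sum_i pospart (- z 0 i)%R)%N%:Z.
  have PoszE F : (\sum_(i < n) F i)%N%:Z = \sum_(i < n) (F i)%:Z.
    by apply: (big_morph Posz).
  by rewrite !PoszE -sumrB; apply: eq_bigr => i _; apply: pospartB.
have -> : (\sum_i `|z 0%R i| = \sum_i pospart (z 0 i)%R + \sum_i pospart (- z 0 i)%R)%N.
  by rewrite -big_split; apply: eq_bigr => i _; rewrite /= /pospart; do 2!case: ifP; lia.
lia.
Qed.

Lemma root_normN (n : nat) (z : 'rV[int]_n) : root_norm (- z) = root_norm z.
Proof.
rewrite /root_norm; congr (_ + _)%N.
  by apply: eq_bigr => i _; rewrite mxE abszN.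
by rewrite (eq_bigr (fun i => - z 0 i)) => [|i _]; rewrite ?mxE// sumrN abszN.
Qed.

Lemma root_normZ (n : nat) (a : int) (z : 'rV[int]_n) :
  root_norm (a *: z) = (`|a| ^ 2 * root_norm z)%N.
Proof.
rewrite /root_norm mulnDr big_distrr -expnMn -abszM mulr_sumr.
congr (_ + _ ^ 2)%N; first by apply: eq_bigr => i _; rewrite mxE abszM expnMn.
by congr `| _ |%N; apply: eq_bigr => i _; rewrite mxE.
Qed.

(** Here [m] is the theorem's [m - 1]. The coordinates carry the residues 1 to [n]; the last
    coordinate of [A_n] carries 0, invisible to power sums of positive exponent. *)
Lemma craig_root_norm_ge (l n m : nat) (z : 'rV[int]_n) :
    prime l -> (n < l)%N -> (m < l)%N -> z != 0 ->
    (forall j : 'I_m, (l %| (\sum_i z 0 i * i.+1%:Z ^+ j.+1)%R)%Z) ->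
  (2 * m.+1 <= root_norm z)%N.
Proof.
move=> l_pr ltnl ltml z_neq0 lz; rewrite leqNgt; apply/negP => ltNm.
have le_pos : (\sum_i pospart (z 0 i)%R <= m)%N by have := root_norm_ge z; lia.
have le_neg : (\sum_i pospart (- z 0 i)%R <= m)%N.
  have := root_norm_ge (- z); rewrite root_normN.
  have -> : (\sum_i pospart ((- z) 0 i)%R = \sum_i pospart (- z 0 i)%R)%N.
    by apply: eq_bigr => i _; rewrite mxE.
  by lia.
have natF_neq0 v : (0 < v <= m)%N -> v%:R != 0 :> 'F_l.
  move=> /andP[v_gt0 levm]; rewrite -(dvdn_pcharf (pchar_Fp l_pr)).
  by rewrite gtnNdvd// (leq_ltn_trans levm).
pose a (i : 'I_n) : 'F_l := i.+1%:R.
have a_inj : injective a.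
  move=> i j /(congr1 (fun x : 'F_l => x : nat)); rewrite !val_Fp_nat//.
  rewrite !modn_small ?(leq_ltn_trans (ltn_ord _))// => -[ij].
  exact/val_inj.
have a_neq0 i : a i != 0.
  rewrite -(dvdn_pcharf (pchar_Fp l_pr)) gtnNdvd//.
  exact: leq_ltn_trans (ltn_ord i) ltnl.
have psum j : (j < m)%N -> \sum_i a i ^+ j.+1 *+ pospart (z 0 i) =
    \sum_i a i ^+ j.+1 *+ pospart (- z 0 i).
  move=> ltjm; apply/eqP; rewrite -subr_eq0 -sumrB.
  have := lz (Ordinal ltjm); rewrite (dvdz_pcharf (pchar_Fp l_pr)).
  rewrite rmorph_sum /=; congr (_ == _); apply: eq_bigr => i _.
  rewrite {1}(pospartB (z 0 i)) rmorphM rmorphXn rmorphB /= mulrBl.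
  by rewrite !mulr_natl.
have disj i : ((pospart (z 0 i)%R == 0) || (pospart (- z 0 i)%R == 0))%N.
  by rewrite /pospart; do 2!case: ifP; lia.
have pos0 := power_sum_disjoint natF_neq0 a_inj a_neq0 le_pos le_neg psum disj.
have neg0 : forall i, pospart (- z 0 i) = 0%N.
  apply: (power_sum_disjoint natF_neq0 a_inj a_neq0 le_neg le_pos) => [j ltjm|i].
    by rewrite psum.
  by rewrite orbC.
case/negP: z_neq0; apply/eqP/rowP=> i.
by rewrite mxE (pospartB (z 0 i)) pos0 neg0.
Qed.

(** * The code condition modulo 2 *)

Lemma hamming_weightE (n : nat) (c : 'rV['F_2]_n) :
  hamming_weight c = (\sum_i (c 0%R i != 0%R))%N.
Proof.
rewrite /hamming_weight -sum1_card big_mkcond; apply: eq_bigr => i _.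
set b := (i \in _); suff -> : b = (c 0 i != 0) by case: (_ != _).
by apply/idP/idP; rewrite in_setE.
Qed.

Lemma craig_code_root_norm_ge (l n m : nat) (C : pred 'rV['F_2]_n)
    (z : 'rV[int]_n) :
    prime l -> odd l -> (n < l)%N -> (m < l)%N -> z != 0 ->
    (forall c, C c -> c != 0 -> (8 * m.+1 <= hamming_weight c)%N) ->
    C (map_mx intr z) ->
    (forall j : 'I_m, (l %| (\sum_i z 0 i * i.+1%:Z ^+ j.+1)%R)%Z) ->
  (8 * m.+1 <= root_norm z)%N.
Proof.
move=> l_pr l_odd ltnl ltml z_neq0 dC Cz lz.
have [z2|] := eqVneq (map_mx intr z : 'rV['F_2]_n) 0; last first.
  (* The reduction is a nonzero codeword, and each odd coordinate contributes at least 1. *)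
  move=> /(dC _ Cz)/leq_trans; apply.
  rewrite hamming_weightE /root_norm (leq_trans _ (leq_addr _ _))//.
  rewrite leq_sum// => i _; rewrite mxE.
  have [->|zi_neq0] := eqVneq (z 0 i) 0; first by rewrite rmorph0 eqxx.
  by rewrite (leq_trans (leq_b1 _))// expn_gt0 absz_gt0 zi_neq0.
have z_even i : (2 %| (z 0 i)%R)%Z.
  rewrite (dvdz_pcharf (pchar_Fp (isT : prime 2))).
  by have /rowP/(_ i) := z2; rewrite !mxE => ->.
pose y : 'rV[int]_n := \row_i ((z 0 i)%R %/ 2)%Z.
have zy : z = 2 *: y.
  by apply/rowP=> i; rewrite !mxE mulrC divzK.
have y_neq0 : y != 0 by apply: contra_neq z_neq0 => y0; rewrite zy y0 scaler0.
(* Halving divides the squared length by 4, so the bound [2 * m.+1] for [y] suffices. *)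
rewrite zy root_normZ (_ : 8 = 2 ^ 2 * 2)%N// -mulnA leq_mul2l /=.
apply: craig_root_norm_ge ltml y_neq0 _ => // j.
have := lz j; rewrite (eq_bigr (fun i => 2 * (y 0 i * i.+1%:Z ^+ j.+1))).
  (* As [l] is odd, the factor 2 cancels. *)
  by rewrite -mulr_sumr Gauss_dvdzr// coprimezE /= coprimen2.
by move=> i _; rewrite zy mxE mulrA.
Qed.

(** The cokernel of a generator matrix [G] tests membership and has rank [n - \dim C]; passing to
    its [col_base] only cancels a row-free factor. *)
Lemma vspace_parity_check (F : fieldType) (n : nat) (C : {vspace 'rV[F]_n}) :
  exists H : 'M[F]_(n, n - \dim C), forall c, (c \in C) = (c *m H == 0).
Proof.
pose G := \matrix_(i < \dim C) (vbasis C)`_i.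
have freeG : row_free G.
  apply/inj_row_free => v; rewrite mulmx_sum_row => vG0.
  apply/rowP=> i; rewrite mxE.
  have /freeP := basis_free (vbasisP C); apply.
  by rewrite -[RHS]vG0; apply: eq_bigr => j _; rewrite rowK.
have CG c : (c \in C) = (c <= G)%MS.
  apply/idP/idP => [cC|/submxP[v ->]].
    rewrite (coord_vbasis cC) summx_sub// => i _; rewrite scalemx_sub//.
    by rewrite -[_`_i](rowK (fun i => (vbasis C)`_i)) row_sub.
  rewrite mulmx_sum_row rpred_sum// => i _; rewrite rpredZ// rowK.
  by rewrite vbasis_mem// mem_nth// size_tuple.
have <- : \rank (cokermx G) = (n - \dim C)%N by rewrite mxrank_coker (eqP freeG).
exists (col_base (cokermx G)) => c; rewrite CG submxE.
rewrite -{1}[cokermx G]mulmx_base mulmxA.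
rewrite -[in LHS](mul0mx _ (row_base (cokermx G))).
by rewrite (inj_eq (row_free_inj (row_base_free _))).
Qed.

(** * Volume and density of sublattices of [A_n] *)

Definition root_basis (R : pzRingType) (n : nat) : 'M[R]_(n, n + 1) :=
  row_mx 1%:M (const_mx (- 1)).

(** The rows of [root_basis] are [e_i - e_(n+1)], so the Gram matrix is the identity plus the
    all-ones matrix, a column times a row. *)
Lemma det_root_gram (R : comNzRingType) (n : nat) :
  \det (root_basis R n *m (root_basis R n)^T) = n.+1%:R.
Proof.
rewrite tr_row_mx mul_row_col trmx1 mulmx1 det_1D_col_row mxE.
rewrite (eq_bigr (fun=> 1)) => [|i _]; last by rewrite !mxE mulrNN mulr1.
by rewrite sumr_const card_ord -[1]/(1%:R) -natrD.
Qed.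

Lemma euclidean_norm_root (R : realType) (n : nat) (z : 'rV[int]_n) :
  euclidean_norm (map_mx intr z *m root_basis R n) = Num.sqrt (root_norm z)%:R.
Proof.
rewrite /euclidean_norm /root_norm; congr Num.sqrt.
have sqr_abs (x : int) : (`|x| ^ 2)%N%:R = x%:~R ^+ 2 :> R.
  by rewrite natrX natr_absz intr_norm real_normK ?num_real.
rewrite mul_mx_row mulmx1 big_split_ord big_ord1 natrD natr_sum /=; congr (_ + _).
  by apply: eq_bigr => i _; rewrite row_mxEl mxE sqr_abs.
rewrite row_mxEr mxE sqr_abs -sqrrN rmorph_sum -sumrN /=; congr (_ ^+ 2).
by apply: eq_bigr => i _; rewrite !mxE mulrN1.
Qed.

Lemma root_sublattice_density (R : realType) (n d : nat) (T : 'M[int]_n) :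
    (0 < n)%N -> 0 < \det T ->
    (forall w : 'rV_n, w *m T != 0 -> (d <= root_norm (w *m T))%N) ->
  exists (L : set 'rV[R]_(n + 1)) (delta : R),
    [/\ is_lattice n L, is_center_density n L delta
      & (Num.sqrt d%:R / 2) ^+ n / ((\det T)%:~R * Num.sqrt n.+1%:R) <= delta].
Proof.
move=> n_gt0 detT_gt0 dT.
pose A := root_basis R n; pose B := map_mx intr T *m A.
have zB (w : 'rV[int]_n) : map_mx intr w *m B = map_mx intr (w *m T) *m A.
  by rewrite map_mxM mulmxA.
have detB : \det (B *m B^T) = (\det T)%:~R ^+ 2 * n.+1%:R.
  rewrite trmx_mul !mulmxA -(mulmxA _ A) !det_mulmx det_root_gram det_tr det_map_mx.
  by rewrite mulrAC.
have volB : basis_volume B = (\det T)%:~R * Num.sqrt n.+1%:R.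
  by rewrite /basis_volume detB sqrtrM ?sqr_ge0// sqrtr_sqr ger0_norm// ler0z ltW.
have vol_gt0 : 0 < basis_volume B.
  by rewrite volB mulr_gt0 ?ltr0z// sqrtr_gt0 ltr0n.
have freeB : row_free B.
  rewrite -row_leq_rank (leq_trans _ (mxrankM_maxl B B^T))//.
  rewrite row_leq_rank row_free_unit unitmxE unitfE gt_eqF//.
  by rewrite -sqrtr_gt0.
have basisB : is_lattice_basis (zspan B) B by [].
have v_eq0 (w : 'rV[int]_n) : (map_mx intr w *m B == 0) = (w *m T == 0).
  rewrite zB; apply/eqP/eqP => [|->]; last by rewrite map_mx0 mul0mx.
  rewrite mul_mx_row mulmx1 => /eqP; rewrite row_mx_eq0 => /andP[/eqP wT0 _].
  by apply/rowP=> i; have /rowP/(_ i) := wT0; rewrite !mxE => /eqP;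
    rewrite intr_eq0 => /eqP.
have normB (w : 'rV[int]_n) :
    euclidean_norm (map_mx intr w *m B) = Num.sqrt (root_norm (w *m T))%:R.
  by rewrite zB euclidean_norm_root.
(* Squared lengths are natural numbers, so well-ordering yields a shortest nonzero vector. *)
pose P N := `[< exists w : 'rV[int]_n, w *m T != 0 /\ root_norm (w *m T) = N >].
have exP : exists N, P N.
  (* The first row of [T] is nonzero, as the adjugate maps it to [\det T] times a unit vector. *)
  pose w : 'rV[int]_n := delta_mx 0 (Ordinal n_gt0).
  exists (root_norm (w *m T)); apply/asboolP; exists w; split=> //.
  apply/eqP => /(congr1 (fun v => v *m \adj T)).
  rewrite -mulmxA mul_mx_adj mul0mx mul_mx_scalar => /rowP/(_ (Ordinal n_gt0)).
  by rewrite !mxE !eqxx mulr1 => detT0; rewrite detT0 in detT_gt0.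
case: (ex_minnP exP) => N /asboolP[w [w_neq0 wN]] minN.
pose lam : R := Num.sqrt N%:R.
exists (zspan B), ((lam / 2) ^+ n / basis_volume B); split.
- by exists B.
- exists B, lam; split=> //; split.
    exists (map_mx intr w *m B); rewrite normB wN v_eq0; split=> //.
    by exists w.
  move=> _ [u ->]; rewrite v_eq0 normB => u_neq0.
  by rewrite ler_sqrt// ?ler0n// ler_nat minN//; apply/asboolP; exists u.
rewrite -volB ler_pM2r ?invr_gt0//.
rewrite lerXn2r ?nnegrE ?divr_ge0 ?sqrtr_ge0// ler_pM2r ?invr_gt0//.
by rewrite ler_sqrt ?ler0n// ler_nat -wN dT.
Qed.

(** * Comparison with the stated bound and conclusion *)

Lemma ge_powR_density (R : realType) (n k m l : nat) (D : int) :
    (0 < m)%N -> (0 < l)%N -> (k <= n)%N -> 0 < D ->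
    D <= (2 ^ (n - k) * l ^ (m - 1))%N%:Z ->
  2 `^ (k%:R - n%:R / 2) * m%:R `^ (n%:R / 2)
    / (l%:R ^+ (m - 1) * (n%:R + 1) `^ (1 / 2)) <=
  (Num.sqrt (8 * m)%N%:R / 2) ^+ n / (D%:~R * Num.sqrt n.+1%:R) :> R.
Proof.
move=> m_gt0 l_gt0 lekn D_gt0 leD.
have sqrt2 : Num.sqrt (8 * m)%N%:R / 2 = Num.sqrt (2 * m%:R) :> R.
  rewrite (_ : (8 * m)%N%:R = 2 ^+ 2 * (2 * m%:R) :> R); last by rewrite natrM; ring.
  by rewrite [Num.sqrt (_ ^+ 2 * _)]sqrtrM ?sqr_ge0// sqrtr_sqr ger0_norm//; field.
rewrite sqrt2 -!powR12_sqrt ?mulr_ge0// -[(_ `^ _) ^+ n]powR_mulrn ?powR_ge0// -powRrM powRM//.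
rewrite div1r [2^-1 * _]mulrC -[n.+1%:R]natr1 powRB ?pnatr_eq0 ?implybT// powR_mulrn//.
(* Here [a] is [2^(n/2)], and [2^(k - n/2) = 2^k / a = a / 2^(n-k)]. *)
set a := 2 `^ _; set b := m%:R `^ _; set c := _ `^ _.
have a_gt0 : 0 < a by rewrite powR_gt0.
have aa : a * a = 2 ^+ n.
  rewrite -powRD ?pnatr_eq0 ?implybT// -splitr powR_mulrn//.
have -> : 2 ^+ k / a = a / 2 ^+ (n - k).
  apply/eqP; rewrite eqr_div ?expf_neq0 ?pnatr_eq0 ?lt0r_neq0//.
  by rewrite aa -exprD subnKC.
have b_ge0 : 0 <= b by apply: powR_ge0.
have c_gt0 : 0 < c by rewrite powR_gt0// ltr_wpDl.
have l_gt0' : 0 < l%:R ^+ (m - 1) :> R by rewrite exprn_gt0// ltr0n.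
rewrite [leLHS](_ : _ = a * b / (2 ^+ (n - k) * l%:R ^+ (m - 1) * c)); last first.
  by rewrite !invfM; ring.
rewrite ler_wpM2l ?mulr_ge0 ?(ltW a_gt0)//.
have D_gt0' : 0 < D%:~R :> R by rewrite ltr0z.
have N_gt0 : 0 < 2 ^+ (n - k) * l%:R ^+ (m - 1) :> R by rewrite mulr_gt0// exprn_gt0.
rewrite lef_pV2 ?posrE ?(mulr_gt0 _ c_gt0)// ler_pM2r//.
by move: leD; rewrite -(ler_int R) -pmulrn natrM !natrX.
Qed.

Theorem theorem2p4 (R : realType) (n m l k : nat)
    (n_gt0 : (0 < n)%N) (m_gt0 : (0 < m)%N)
    (m_le : m%:R <= (n%:R + 1) / 2 :> R)
    (l_ge : (n + 1 <= l)%N) (l_odd : odd l) (l_prime : prime l)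
    (code : exists C : {vspace 'rV['F_2]_n}, is_binary_code k (8 * m) C) :
  exists (L : set 'rV[R]_(n + 1)) (delta : R),
    [/\ is_lattice n L, is_center_density n L delta
      & 2 `^ (k%:R - n%:R / 2) * m%:R `^ (n%:R / 2)
          / (l%:R ^+ (m - 1) * (n%:R + 1) `^ (1 / 2)) <= delta].
Proof.
have {m_le} ltml : (m - 1 < l)%N.
  move: m_le; rewrite ler_pdivlMr// -natrM natr1 ler_nat; lia.
have {l_ge} ltnl : (n < l)%N by rewrite -addn1.
case: code => C [dimC _ dC].
have lekn : (k <= n)%N.
  by rewrite -dimC (leq_trans (dimvS (subvf C)))// dimvf /dim /= mul1n.
have [H CH] := vspace_parity_check C; rewrite dimC in H CH.
(* Each parity check, lifted to the integers, is a congruence modulo 2; each exponent from 1 to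
   [m - 1] gives one modulo [l]. *)
pose parity (j : 'I_(n - k)) := (2%N, \col_i (H i j : nat)%:Z).
pose power (j : 'I_(m - 1)) := (l, \col_(i < n) i.+1%:Z ^+ j.+1).
pose s := codom parity ++ codom power.
have s_prime : all (fun pc => prime pc.1) s.
  by apply/allP => pc; rewrite mem_cat => /orP[] /codomP[j ->].
have [T [detT_gt0 detT_le zT]] := congruence_lattice_basis s_prime.
have dT (w : 'rV_n) : w *m T != 0 -> (8 * m <= root_norm (w *m T))%N.
  move=> wT_neq0; have [/(_ (ex_intro _ w erefl))/allP sT _] := zT (w *m T).
  have parT j : (2 %| ((w *m T *m (parity j).2) 0 0)%R)%Z.
    by apply: (sT (parity j)); rewrite mem_cat codom_f.
  have powT j : (l %| ((w *m T *m (power j).2) 0 0)%R)%Z.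
    by apply: (sT (power j)); rewrite mem_cat codom_f orbT.
  rewrite -[m]prednK// -subn1.
  apply: (craig_code_root_norm_ge (C := mem C) l_prime) => //= [c cC c_neq0||j].
  - by rewrite subn1 prednK// dC.
  - rewrite CH; apply/eqP/rowP=> j.
    have := parT j; rewrite /= (dvdz_pcharf (pchar_Fp (isT : prime 2))).
    rewrite !mxE rmorph_sum /= => /eqP sum0; rewrite -[RHS]sum0.
    apply: eq_bigr => i _; rewrite !mxE rmorphM /=; congr (_ * _).
    by rewrite -[LHS]natr_Zp.
  have := powT j; rewrite /= mxE.
  rewrite (eq_bigr (fun i => (w *m T) 0 i * i.+1%:Z ^+ j.+1)) // => i _.
  by rewrite [X in _ * X]mxE.
have [L [delta [latL densL le_delta]]] := root_sublattice_density R n_gt0 detT_gt0 dT.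
exists L, delta; split=> //; apply: le_trans le_delta.
apply: ge_powR_density => //; first exact: prime_gt0.
by move: detT_le; rewrite big_cat !big_image !prod_nat_const !card_ord.
Qed.
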